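(* Let $X$ be an Archimedean vector lattice and $\tau$ a Hausdorff locally solid topology on $X$ with the Fatou property. Assume that the carrier $C_\tau$ has a countable order basis and let $(x_\alpha)_{\alpha\in A}$ be a net in $X$. If $x_\alpha\xrightarrow{\tau}0$ in $X$, then there exists an increasing sequence of indices $\alpha_n\in A$ such that $x_{\alpha_n}\xrightarrow{uo}0$ in $X$.
   Context: All vector lattices are assumed Archimedean. A linear topology on a vector lattice is locally solid if it has a base at zero consisting of solid sets. It has the Fatou property if it has a base at zero consisting of solid and order closed sets. A net $(x_\alpha)$ converges in order to $x$, $x_\alpha\xrightarrow{o}x$, if there is a net $(y_\beta)$, possibly over a different index set, with $y_\beta\downarrow 0$ and such that for every $\beta$ there is $\alpha_0$ with $|x_\alpha-x|\le y_\beta$ for all $\alpha\ge\alpha_0$. The net $uo$-converges to $x$, $x_\alpha\xrightarrow{uo}x$, if $|x_\alpha-x|\wedge u\xrightarrow{o}0$ for every $u\in X_+$. Carrier: a sequence $\{V_n\}$ of sets is normal if $V_{n+1}+V_{n+1}\subseteq V_n$ for all $n$. The carrier of a locally solid topology $\tau$ is $C_\tau=\bigcup N^d$, the union being over all sets of the form $N=\bigcap_{n=1}^\infty V_n$ where $\{V_n\}$ is a normal sequence of solid $\tau$-neighbourhoods of zero; here $N^d$ is the disjoint complement of $N$ in $X$. $C_\tau$ is an ideal of $X$. A vector lattice $Y$ has a countable order basis if there is an at most countable set $C\subseteq Y$ such that the band generated by $C$ in $Y$ is $Y$. (For $C_\tau$ this is applied with $Y=C_\tau$.) *)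

(* Defs.v *)
From HB Require Import structures.
From mathcomp Require Import all_boot all_order all_algebra.
From mathcomp Require Import all_classical all_reals all_analysis.
Set Implicit Arguments.
Unset Strict Implicit.
Unset Printing Implicit Defensive.
Import Order.TTheory GRing.Theory Num.Theory.
Import numFieldNormedType.Exports.
Local Open Scope classical_set_scope.
Local Open Scope ring_scope.

(* The lattice operations are fields because the hierarchy has no common
   refinement of [Order.Lattice] and [Num.POrderedZmodule] from which this
   structure could inherit them without also being a [realDomainType]. *)
HB.mixin Record isVectorLattice (R : realType) X
    & GRing.Lmodule R X & Num.POrderedZmodule X := {
  vlat_join : X -> X -> X ;
  vlat_meet : X -> X -> X ;
  vlat_leD2r : forall x y z : X, x <= y -> x + z <= y + z ;
  vlat_scale_ge0 : forall (a : R) (x : X), 0 <= a -> 0 <= x -> 0 <= a *: x ;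
  vlat_joinP : forall x y z : X, (vlat_join x y <= z) = (x <= z) && (y <= z) ;
  vlat_meetP : forall x y z : X, (z <= vlat_meet x y) = (z <= x) && (z <= y)
}.

#[short(type="vectorLatticeType")]
HB.structure Definition VectorLattice (R : realType) :=
  {X of GRing.Lmodule R X & Num.POrderedZmodule X & isVectorLattice R X}.

(* No compatibility between order and topology is built in: see
   [locally_solid] below. *)
#[short(type="topVectorLatticeType")]
HB.structure Definition TopVectorLattice (R : realType) :=
  {X of VectorLattice R X & TopologicalLmodule R X}.

(* The relation is a preorder; antisymmetry is not required. *)
Record directedSet := DirectedSet {
  dir_sort :> Type ;
  dir_le : dir_sort -> dir_sort -> Prop ;
  dir_refl : forall a, dir_le a a ;
  dir_trans : forall b a c, dir_le a b -> dir_le b c -> dir_le a c ;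
  dir_inhabited : inhabited dir_sort ;
  dir_directed : forall a b, exists2 c, dir_le a c & dir_le b c
}.

Lemma nat_dir_directed (m n : nat) : exists2 p : nat, (m <= p)%N & (n <= p)%N.
Proof. by exists (maxn m n); [exact: leq_maxl|exact: leq_maxr]. Qed.

Definition nat_directed : directedSet :=
  @DirectedSet nat (fun m n => (m <= n)%N) leqnn (fun n m p => @leq_trans n m p)
    (inhabits 0%N) nat_dir_directed.

Definition net_tails (A : directedSet) : set_system A :=
  [set S | exists a0 : A, forall a : A, dir_le a0 a -> S a].

Arguments net_tails : clear implicits.

Section VectorLattice.
Context {R : realType} {X : vectorLatticeType R}.
Implicit Types (x y u l : X) (S N B C Y : set X).

Definition vlat_abs x : X := vlat_join x (- x).

Definition archimedean_vlat : Prop :=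
  forall x, 0 <= x -> infimums (range (fun n : nat => n.+1%:R^-1 *: x)) 0.

Definition solid S : Prop :=
  forall x y, vlat_abs x <= vlat_abs y -> S y -> S x.

Definition disjoint_complement N : set X :=
  [set x | forall y, N y -> vlat_meet (vlat_abs x) (vlat_abs y) = 0].

(* The notions suffixed by [_in Y] are those of the vector lattice [Y], for a
   vector sublattice [Y] of [X] given as a set: everything that the notion
   quantifies over ranges over [Y], and in particular the infimum of a net is
   its greatest lower bound among the elements of [Y]. *)

Definition decreases_to0_in Y (I : directedSet) (y : I -> X) : Prop :=
  [/\ range y `<=` Y,
      forall i j : I, dir_le i j -> y j <= y i,
      lbound (range y) 0
    & ubound (Y `&` lbound (range y)) 0].

Definition order_cvg_in Y (A : directedSet) (x : A -> X) l : Prop :=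
  exists (I : directedSet) (y : I -> X),
    decreases_to0_in Y y /\
    forall i : I, exists a0 : A, forall a : A, dir_le a0 a ->
      vlat_abs (x a - l) <= y i.

Definition order_closed_in Y S : Prop :=
  forall (A : directedSet) (x : A -> X) l,
    (forall a, S (x a)) -> Y l -> order_cvg_in Y x l -> S l.

Definition ideal_in Y B : Prop :=
  [/\ B `<=` Y,
      B 0,
      forall (a : R) x y, B x -> B y -> B (a *: x + y)
    & forall x y, Y x -> vlat_abs x <= vlat_abs y -> B y -> B x].

Definition band_in Y B : Prop := ideal_in Y B /\ order_closed_in Y B.

Definition countable_order_basis Y : Prop :=
  exists C, [/\ C `<=` Y, countable C & smallest (band_in Y) C = Y].

Definition order_cvg (A : directedSet) (x : A -> X) l : Prop :=
  order_cvg_in setT x l.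

Definition order_closed S : Prop := order_closed_in setT S.

Definition uo_cvg (A : directedSet) (x : A -> X) l : Prop :=
  forall u, 0 <= u ->
    order_cvg (fun a => vlat_meet (vlat_abs (x a - l)) u) 0.

Definition normal_seq (V : nat -> set X) : Prop :=
  forall n, [set x + y | x in V n.+1 & y in V n.+1] `<=` V n.

End VectorLattice.

Arguments archimedean_vlat {R} X.

Section TopVectorLattice.
Context {R : realType} (X : topVectorLatticeType R).

Definition locally_solid : Prop :=
  exists2 B : set_system X, B `<=` solid & nbhs (0 : X) = filter_from B id.

Definition fatou_property : Prop :=
  exists2 B : set_system X, B `<=` [set V | solid V /\ order_closed V]
    & nbhs (0 : X) = filter_from B id.

Definition carrier : set X :=
  [set x | exists V : nat -> set X,
    [/\ forall n, solid (V n) /\ nbhs (0 : X) (V n),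
        normal_seq V
      & disjoint_complement (\bigcap_n V n) x]].

End TopVectorLattice.

Arguments carrier {R} X.

(* Main.v *)
Require Import Defs.
From mathcomp Require Import all_boot all_order all_algebra.
From mathcomp Require Import all_classical all_reals all_analysis.
Import Order.TTheory GRing.Theory Num.Theory.
Import numFieldNormedType.Exports.
Local Open Scope classical_set_scope.
Local Open Scope ring_scope.

(** Some countable family of zero neighbourhoods already separates points, so
the net may be replaced by a fast sequence taken out of it.

Separation. Let N be the intersection of a normal sequence of solid, order
closed neighbourhoods of 0. It is a band, so N = N^dd by the Archimedean
property, and N^d lies in the carrier. An element disjoint from the carrier is
therefore in every such N; by the Fatou property every neighbourhood of 0
contains one, so the element is 0 by Hausdorffness
([disjoint_complement_carrier]). The members of a countable order basis C of the
carrier have countably many witnessing normal sequences, which combine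
diagonally into one normal sequence (U n) with C inside (\bigcap_n U n)^d. That complement is a
band of the carrier, hence is the whole carrier; so \bigcap_n U n is disjoint
from the carrier and equals {0} ([normal_seq_separating]). By the Fatou
property the U n may be shrunk to order closed sets W n.

Extraction. Choose increasing indices with x_n in W n. The sums
s n m = \sum_(n < k <= n + m) |x_k| stay in W n by normality. For u >= 0, the
pairs (n, z) with z an upper bound of all u /\ s n m, ordered by increasing n
and decreasing z, form a directed set, and z eventually dominates |x_k| /\ u.
It remains to see that 0 is the greatest lower bound of these z. In a
lattice where suprema exist a lower bound w >= 0 would lie below
sup_m (u /\ s n m); in general it is still the supremum of the
w /\ (u /\ s n m) ([meet_lower_bound_sup]), which is enough for the order closed
set W n to contain w. This holds for each n, so w = 0. *)

(** * Arithmetic of vector lattices *)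

Section VectorLatticeTheory.
Context {R : realType} {X : vectorLatticeType R}.
Implicit Types (x y z u w a b c d : X) (N S D T : set X).

Local Notation join := (@vlat_join R X).
Local Notation meet := (@vlat_meet R X).
Local Notation abs := (@vlat_abs R X).

Lemma vlat_lerD2r z x y : (x + z <= y + z) = (x <= y).
Proof.
apply/idP/idP; last exact: vlat_leD2r.
by move=> /(vlat_leD2r _ _ (- z)); rewrite !addrK.
Qed.

Lemma vlat_lerD2l z x y : (z + x <= z + y) = (x <= y).
Proof. by rewrite ![z + _]addrC vlat_lerD2r. Qed.

Lemma vlat_lerD x y z u : x <= y -> z <= u -> x + z <= y + u.
Proof. by move=> xy zu; apply: (@le_trans _ _ (y + z)); rewrite ?vlat_lerD2r ?vlat_lerD2l. Qed.

Lemma vlat_addr_ge0 x y : 0 <= x -> 0 <= y -> 0 <= x + y.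
Proof. by move=> x0 y0; rewrite -[0]addr0 vlat_lerD. Qed.

Lemma vlat_subr_ge0 x y : (0 <= y - x) = (x <= y).
Proof. by rewrite -(vlat_lerD2r x 0) add0r subrK. Qed.

Lemma vlat_lerBrDr x y z : (x <= y - z) = (x + z <= y).
Proof. by rewrite -(vlat_lerD2r z) subrK. Qed.

Lemma vlat_lerBlDr x y z : (x - z <= y) = (x <= y + z).
Proof. by rewrite -(vlat_lerD2r z (x - z)) subrK. Qed.

Lemma vlat_lerN2 x y : (- x <= - y) = (y <= x).
Proof. by rewrite -(vlat_subr_ge0 (- x)) opprK addrC vlat_subr_ge0. Qed.

Lemma vlat_meet_lel x y : meet x y <= x.
Proof. by have := lexx (meet x y); rewrite vlat_meetP => /andP[]. Qed.

Lemma vlat_meet_ler x y : meet x y <= y.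
Proof. by have := lexx (meet x y); rewrite vlat_meetP => /andP[]. Qed.

Lemma vlat_join_gel x y : x <= join x y.
Proof. by have := lexx (join x y); rewrite vlat_joinP => /andP[]. Qed.

Lemma vlat_join_ger x y : y <= join x y.
Proof. by have := lexx (join x y); rewrite vlat_joinP => /andP[]. Qed.

Lemma vlat_meet_l x y : x <= y -> meet x y = x.
Proof. by move=> xy; apply/le_anti; rewrite vlat_meet_lel vlat_meetP lexx. Qed.

Lemma vlat_meetC x y : meet x y = meet y x.
Proof.
by apply/le_anti; rewrite !vlat_meetP !vlat_meet_lel !vlat_meet_ler.
Qed.

Lemma vlat_leI2 x y z u : x <= y -> z <= u -> meet x z <= meet y u.
Proof.
move=> xy zu; rewrite vlat_meetP (le_trans (vlat_meet_lel _ _) xy).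
exact: le_trans (vlat_meet_ler _ _) zu.
Qed.

Lemma vlat_addr_meet z x y : meet x y + z = meet (x + z) (y + z).
Proof.
apply/le_anti; rewrite vlat_meetP !vlat_lerD2r vlat_meet_lel vlat_meet_ler /=.
by rewrite -vlat_lerBlDr vlat_meetP !vlat_lerBlDr vlat_meet_lel vlat_meet_ler.
Qed.

(** Half of the identity x \/ y = x + y - x /\ y. *)
Lemma vlat_join_le_addB x y z :
  x <= z -> y <= z -> x + y - meet x y <= z.
Proof.
move=> xz yz; rewrite vlat_lerBlDr [z + _]addrC vlat_addr_meet vlat_meetP.
by rewrite vlat_lerD2l yz addrC vlat_lerD2l.
Qed.

Lemma vlat_le_abs x : x <= abs x.
Proof. exact: vlat_join_gel. Qed.

Lemma vlat_abs_le x z : (abs x <= z) = (x <= z) && (- x <= z).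
Proof. exact: vlat_joinP. Qed.

Lemma vlat_leNabs x : - x <= abs x.
Proof. exact: vlat_join_ger. Qed.

Lemma vlat_scale_mono (e : R) x y : 0 <= e -> x <= y -> e *: x <= e *: y.
Proof.
by move=> e0 xy; rewrite -vlat_subr_ge0 -scalerBr vlat_scale_ge0 ?vlat_subr_ge0.
Qed.

Lemma vlat_abs_ge0 x : 0 <= abs x.
Proof.
have : 0 <= abs x + abs x.
  by rewrite -(subrr x) vlat_lerD ?vlat_le_abs ?vlat_leNabs.
have half0 : (0 : R) <= 2^-1 by rewrite invr_ge0.
rewrite -mulr2n -scaler_nat => /(vlat_scale_mono _ _ _ half0).
by rewrite scaler0 scalerA mulVf ?pnatr_eq0// scale1r.
Qed.

Lemma vlat_ge0_abs x : 0 <= x -> abs x = x.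
Proof.
move=> x0; apply/le_anti; rewrite vlat_le_abs andbT vlat_abs_le lexx /=.
by apply: (@le_trans _ _ 0) => //; rewrite -vlat_subr_ge0 sub0r opprK.
Qed.

Lemma vlat_abs_abs x : abs (abs x) = abs x.
Proof. by rewrite vlat_ge0_abs ?vlat_abs_ge0. Qed.

Lemma vlat_absN x : abs (- x) = abs x.
Proof.
have absN_le y : abs (- y) <= abs y.
  by rewrite vlat_abs_le opprK vlat_le_abs vlat_leNabs.
by apply/le_anti; rewrite absN_le -{1}[x]opprK absN_le.
Qed.

Lemma vlat_absD x y : abs (x + y) <= abs x + abs y.
Proof.
by rewrite vlat_abs_le opprD !vlat_lerD ?vlat_le_abs ?vlat_leNabs.
Qed.

Lemma vlat_abs_scale (e : R) x (k : nat) :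
  `|e| <= k%:R -> abs (e *: x) <= abs x *+ k.
Proof.
have scale_le (b : R) y : 0 <= b <= k%:R -> b *: y <= abs y *+ k.
  case/andP=> b0 bk; apply: le_trans (vlat_scale_mono _ _ _ b0 (vlat_le_abs y)) _.
  rewrite -scaler_nat -vlat_subr_ge0 -scalerBl.
  by rewrite vlat_scale_ge0 ?vlat_abs_ge0// subr_ge0.
case: (ger0P e) => [e0|/ltW e0] ek; rewrite vlat_abs_le.
  by rewrite scale_le ?e0//= -scalerN -(vlat_absN x) scale_le// e0.
have Ne0 : 0 <= - e <= k%:R by rewrite oppr_ge0 e0.
rewrite -scaleNr (scale_le (- e))// andbT.
have -> : e *: x = (- e) *: (- x) by rewrite scalerN scaleNr opprK.
by rewrite -(vlat_absN x) scale_le.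
Qed.

Lemma vlat_sum_abs_ge0 m (f : 'I_m -> X) : 0 <= \sum_(k < m) abs (f k).
Proof.
apply: (big_ind (fun z => 0 <= z)) => // [y z|k _]; first exact: vlat_addr_ge0.
exact: vlat_abs_ge0.
Qed.

Lemma vlat_meet_ge0 x y : 0 <= x -> 0 <= y -> 0 <= meet x y.
Proof. by move=> x0 y0; rewrite vlat_meetP x0. Qed.

Lemma vlat_meet0l x : 0 <= x -> meet 0 x = 0.
Proof. exact: vlat_meet_l. Qed.

(** Subadditivity of truncation: expanding the right-hand side by translation
invariance gives the meet of x + y, x + z, z + y and z + z. *)
Lemma vlat_meetDl x y z : 0 <= x -> 0 <= y -> 0 <= z ->
  meet (x + y) z <= meet x z + meet y z.
Proof.
move=> x0 y0 z0; rewrite vlat_addr_meet vlat_meetP ![_ + meet y z]addrC.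
rewrite !vlat_addr_meet !vlat_meetP; set m := meet _ _.
have mz : m <= z := vlat_meet_ler _ _.
have mDz u : 0 <= u -> m <= z + u by move=> u0; rewrite -[m]addr0 vlat_lerD.
by rewrite !mDz// [y + x]addrC vlat_meet_lel [y + z]addrC mDz.
Qed.

Lemma vlat_meet_mulrn x z (k : nat) :
  0 <= x -> 0 <= z -> meet x z = 0 -> 0 <= x *+ k /\ meet (x *+ k) z = 0.
Proof.
move=> x0 z0 xz; elim: k => [|k [k0 kz]]; first by rewrite mulr0n vlat_meet0l.
have kS : 0 <= x *+ k.+1 by rewrite mulrS vlat_addr_ge0.
split=> //; apply/le_anti; rewrite vlat_meet_ge0// andbT mulrS.
by apply: le_trans (vlat_meetDl _ _ _ x0 k0 z0) _; rewrite xz kz addr0.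
Qed.

(** * The Archimedean property and suprema *)

Lemma archimedean_le0 (X_arch : archimedean_vlat X) d z :
  (forall k : nat, d *+ k <= z) -> d <= 0.
Proof.
move=> dz; have z0 : 0 <= z by have := dz 0%N; rewrite mulr0n.
have [_] := X_arch z z0; apply => _ [k _ <-].
have k0 : (0 : R) <= k.+1%:R^-1 by rewrite invr_ge0.
have := vlat_scale_mono _ _ _ k0 (dz k.+1).
by rewrite -(scaler_nat _ d) scalerA mulVf ?pnatr_eq0// scale1r.
Qed.

(** A substitute for the infinite distributive law when T has no supremum. If v
bounds all w /\ t, put d = w - v. For any upper bound z of T,
t + d <= t + w - w /\ t = t \/ w <= z, so z - d is again an upper bound of T.
Iterating, z - k d bounds T and stays above w for all k, so that d <= 0. *)
Lemma meet_lower_bound_sup (X_arch : archimedean_vlat X) T w :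
  ubound T !=set0 -> lbound (ubound T) w -> supremums (meet w @` T) w.
Proof.
move=> [z0 Tz0] wT; split=> [_ [t _ <-]|v vT]; first exact: vlat_meet_lel.
rewrite -vlat_subr_ge0 -vlat_lerN2 oppr0 opprB.
apply: (archimedean_le0 X_arch _ (z0 - w)) => k.
(* Subtracting d from an upper bound of T can be repeated indefinitely. *)
suff /wT : ubound T (z0 - (w - v) *+ k).
  by rewrite !vlat_lerBrDr addrC.
elim: k => [|k IHk]; first by rewrite mulr0n subr0.
move=> t Tt; rewrite mulrSr opprD addrA vlat_lerBrDr.
apply: le_trans (vlat_join_le_addB _ _ _ (wT _ IHk) (IHk t Tt)).
rewrite [w + t]addrC -addrA vlat_lerD2l vlat_lerD2l vlat_lerN2.
by apply: vT; exists t.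
Qed.

(** * Order closed sets *)

(** An upward directed set, indexed by itself, is a net converging in order to
its supremum: the differences w - a decrease to 0. *)
Lemma order_closed_directed_sup S D w : order_closed S -> D `<=` S ->
  D !=set0 -> (forall a b, D a -> D b -> exists2 c, D c & a <= c /\ b <= c) ->
  supremums D w -> S w.
Proof.
move=> Scl DS [a0 Da0] Ddir [Dw wD].
have sigD (p q : {a | D a}) :
    exists2 r : {a | D a}, sval p <= sval r & sval q <= sval r.
  by have [c Dc [pc qc]] := Ddir _ _ (svalP p) (svalP q); exists (exist _ c Dc).
pose A := @DirectedSet {a | D a} (fun p q => sval p <= sval q)
  (fun p => lexx _) (fun q p r => @le_trans _ _ _ _ _) (inhabits (exist _ a0 Da0)) sigD.
apply: (Scl A sval w) => //; first by move=> p; apply: DS; apply: svalP.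
exists A, (fun p => w - sval p); split; last first.
  move=> p; exists p => q /= pq.
  have qw : sval q <= w by apply: Dw; apply: svalP.
  rewrite -vlat_absN opprB vlat_ge0_abs ?vlat_subr_ge0//.
  by rewrite vlat_lerD2l vlat_lerN2.
split=> //.
- by move=> p q /= pq; rewrite vlat_lerD2l vlat_lerN2.
- by move=> _ [p _ <-]; rewrite vlat_subr_ge0; apply: Dw; apply: svalP.
move=> v [_ vD]; suff /wD : ubound D (w - v).
  by rewrite vlat_lerBrDr -[X in _ <= X]addr0 vlat_lerD2l.
move=> a Da; have := vD _ (ex_intro2 _ _ (exist _ a Da) I erefl).
by rewrite /= !vlat_lerBrDr addrC.
Qed.

(** * Disjoint complements *)

Lemma disjoint_complement_ideal N : ideal_in setT (disjoint_complement N).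
Proof.
split=> //.
- move=> y _; rewrite vlat_ge0_abs// vlat_meet0l//; exact: vlat_abs_ge0.
- move=> e x y xN yN z Nz.
  have [k ek] : exists k : nat, `|e| <= k%:R.
    by exists (Num.bound `|e|); exact/ltW/archi_boundP.
  have z0 := vlat_abs_ge0 z.
  have [k0 kz] := vlat_meet_mulrn _ _ k (vlat_abs_ge0 x) z0 (xN z Nz).
  apply/le_anti; rewrite vlat_meet_ge0 ?vlat_abs_ge0// andbT.
  apply: le_trans (_ : meet (abs x *+ k + abs y) (abs z) <= _).
    apply: vlat_leI2 => //; apply: le_trans (vlat_absD _ _) _.
    by rewrite vlat_lerD2r vlat_abs_scale.
  by apply: le_trans (vlat_meetDl _ _ _ k0 (vlat_abs_ge0 y) z0) _; rewrite kz yN// addr0.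
move=> x y _ xy yN z Nz; apply/le_anti.
rewrite vlat_meet_ge0 ?vlat_abs_ge0// andbT -(yN z Nz).
exact: vlat_leI2.
Qed.

(** Order limits inside Y are tested only against lower bounds lying in Y;
solidity of Y places |l| /\ |z| among them. *)
Lemma disjoint_complement_band_in Y N : solid Y ->
  disjoint_complement N `<=` Y -> band_in Y (disjoint_complement N).
Proof.
move=> Ysol NY; have [_ N0 Nlin Nsol] := disjoint_complement_ideal N.
split; first by split=> // x y _; apply: Nsol.
move=> A x l xN Yl [I [y [[_ _ _ y0] xy]]] z Nz.
apply/le_anti; rewrite vlat_meet_ge0 ?vlat_abs_ge0// andbT.
apply: y0; split.
  by apply: Ysol Yl; rewrite vlat_ge0_abs ?vlat_meet_ge0 ?vlat_abs_ge0// vlat_meet_lel.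
move=> _ [i _ <-]; have [a0 /(_ a0 (dir_refl a0)) xa0] := xy i.
apply: le_trans xa0; have z0 := vlat_abs_ge0 z.
apply: (@le_trans _ _ (meet (abs (x a0 - l) + abs (x a0)) (abs z))).
  apply: vlat_leI2 => //; rewrite -[abs (_ - _)]vlat_absN opprB.
  by apply: le_trans (vlat_absD _ _); rewrite subrK.
apply: le_trans (vlat_meetDl _ _ _ (vlat_abs_ge0 _) (vlat_abs_ge0 _) z0) _.
by rewrite xN// addr0 vlat_meet_lel.
Qed.

(** An element x of N^dd is approximated from below by the part D of N between 0
and b = |x|. If v bounds D, the gap d = b - v /\ b is disjoint from N: adding
w = d /\ |n| to an element of D gives another one, so all multiples of w stay
below b and w = 0. Being also in N^dd, the gap vanishes, so b is the supremum
of D. *)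
Lemma disjoint_complementK (X_arch : archimedean_vlat X) N : solid N ->
  N 0 -> (forall x y, N x -> N y -> N (x + y)) -> order_closed N ->
  disjoint_complement (disjoint_complement N) `<=` N.
Proof.
move=> Nsol N0 ND Ncl x xNdd; apply: (Nsol _ (abs x)); first by rewrite vlat_abs_abs.
set b := abs x; have b0 : 0 <= b := vlat_abs_ge0 x.
pose D := [set y | [/\ N y, 0 <= y & y <= b]].
have D0 : D 0 by split.
apply: (order_closed_directed_sup N D) => //.
- by move=> y [].
- by exists 0.
- move=> y z [Ny y0 yb] [Nz z0 zb]; exists (join y z); last first.
    by rewrite vlat_join_gel vlat_join_ger.
  have j0 : 0 <= join y z by apply: le_trans (vlat_join_gel _ _).
  split=> //; last by rewrite vlat_joinP yb.
  apply: (Nsol _ (y + z)); last exact: ND.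
  rewrite !vlat_ge0_abs ?vlat_addr_ge0// vlat_joinP.
  by rewrite -{1}[y]addr0 -{2}[z]add0r vlat_lerD2l vlat_lerD2r z0.
split=> [y []//|v vD]; pose d := b - meet v b.
have m0 : 0 <= meet v b by rewrite vlat_meetP b0 vD.
have d0 : 0 <= d by rewrite vlat_subr_ge0 vlat_meet_ler.
have db : d <= b by rewrite /d vlat_lerBlDr -{1}[b]addr0 vlat_lerD2l.
have dN : disjoint_complement N d.
  move=> n Nn; rewrite (vlat_ge0_abs d)//; set w := meet _ _.
  have w0 : 0 <= w by rewrite vlat_meet_ge0 ?vlat_abs_ge0.
  have Nw : N w by apply: Nsol Nn; rewrite vlat_ge0_abs ?vlat_meet_ler.
  have Dw k : D (w *+ k).
    elim: k => [|k [Nk k0 kb]]; first by rewrite mulr0n.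
    rewrite mulrSr; split; [exact: ND|exact: vlat_addr_ge0|].
    have kv : w *+ k <= meet v b by rewrite vlat_meetP kb andbT; apply: vD.
    apply: le_trans (vlat_lerD _ _ _ _ kv (vlat_meet_lel _ _)) _.
    by rewrite /d addrC subrK.
  apply/le_anti; rewrite w0 andbT.
  by apply: (archimedean_le0 X_arch w b) => k; case: (Dw k).
have d_eq0 : d = 0.
  have dabs := vlat_ge0_abs d d0.
  have [_ _ _ /(_ d x I)] := disjoint_complement_ideal (disjoint_complement N).
  by rewrite dabs => /(_ db xNdd d dN); rewrite dabs vlat_meet_l.
suff -> : b = meet v b by exact: vlat_meet_lel.
by apply/eqP; rewrite -subr_eq0; apply/eqP.
Qed.

(** * Normal sequences of sets *)

Lemma normal_bigcap_add (W : nat -> set X) x y : normal_seq W ->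
  (\bigcap_n W n) x -> (\bigcap_n W n) y -> (\bigcap_n W n) (x + y).
Proof.
move=> Wn Wx Wy n _; apply: Wn; exists x; first exact: Wx.
by exists y => //; apply: Wy.
Qed.

(** Peeling off the first term leaves a sum in W n.+1, just as that term is;
normality puts the total in W n. *)
Lemma normal_seq_sum (W : nat -> set X) (y : nat -> X) : normal_seq W ->
  (forall n, W n 0) -> (forall n, W n (y n)) ->
  forall m n, W n (\sum_(k < m) y (n.+1 + k)%N).
Proof.
move=> Wn W0 Wy; elim=> [|m IHm] n; first by rewrite big_ord0.
rewrite big_ord_recl addn0; apply: Wn; exists (y n.+1) => //.
exists (\sum_(k < m) y (n.+2 + k)%N) => //; congr (_ + _).
by apply: eq_bigr => k _; rewrite /= /bump /= add1n addSnnS.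
Qed.

(** The dominating net is indexed by all pairs (n, z) with z an upper bound of the
truncated sums starting after n, since the truncated tails need not have a
supremum. *)
Lemma uo_cvg_normal_seq (X_arch : archimedean_vlat X) (W : nat -> set X)
    (x : nat -> X) :
  (forall n, solid (W n)) -> (forall n, order_closed (W n)) ->
  (forall n, W n 0) -> normal_seq W -> \bigcap_n W n `<=` [set 0] ->
  (forall n, W n (x n)) -> uo_cvg (A := nat_directed) x 0.
Proof.
move=> Wsol Wcl W0 Wn WI Wx u u0.
pose s n m := \sum_(k < m) abs (x (n.+1 + k)%N).
have s0 n m : 0 <= s n m := vlat_sum_abs_ge0 _ _.
have s_mono n m m' : (m <= m')%N -> s n m <= s n m'.
  move=> /subnKC <-; rewrite /s big_split_ord /= -[X in X <= _]addr0 vlat_lerD2l.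
  exact: vlat_sum_abs_ge0.
have Ws n m : W n (s n m).
  apply: (normal_seq_sum W (fun k => abs (x k))) => // k; apply: Wsol (Wx k).
  by rewrite vlat_abs_abs.
pose T n := [set meet u (s n m) | m in setT].
have T0 n : T n 0 by exists 0%N => //; rewrite /s big_ord0 vlat_meetC vlat_meet0l.
have s_shift n n' m : (n <= n')%N -> s n' m <= s n (n' - n + m)%N.
  move=> nn'; rewrite /s big_split_ord /= -[X in X <= _]add0r; apply: vlat_lerD.
    exact: vlat_sum_abs_ge0.
  rewrite le_eqVlt; apply/orP; left; apply/eqP; apply: eq_bigr => k _.
  by rewrite addnA !addSn subnKC.
have T_shift n n' : (n <= n')%N -> ubound (T n) `<=` ubound (T n').
  move=> nn' z zT _ [m _ <-]; apply: (@le_trans _ _ (meet u (s n (n' - n + m)%N))).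
    by apply: vlat_leI2 => //; exact: s_shift.
  by apply: zT; exists (n' - n + m)%N.
pose J := {p : nat * X | ubound (T p.1) p.2}.
pose leJ (p q : J) := ((sval p).1 <= (sval q).1)%N /\ (sval q).2 <= (sval p).2.
have Tu n : ubound (T n) u by move=> _ [m _ <-]; exact: vlat_meet_lel.
have leJ_refl p : leJ p p by split.
have leJ_trans q p r : leJ p q -> leJ q r -> leJ p r.
  move=> [pq qp] [qr rq]; split; [exact: leq_trans qr|exact: le_trans qp].
have leJ_dir p q : exists2 r, leJ p r & leJ q r.
  case: p q => [[n z] /= zT] [[n' z'] /= z'T].
  have T' : ubound (T (maxn n n')) (meet z z').
    move=> t Tt; rewrite vlat_meetP.
    rewrite (T_shift n _ (leq_maxl n n') z zT t Tt).
    exact: (T_shift n' _ (leq_maxr n n') z' z'T t Tt).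
  exists (exist _ (maxn n n', meet z z') T'); split => /=.
  - exact: leq_maxl.
  - exact: vlat_meet_lel.
  - exact: leq_maxr.
  - exact: vlat_meet_ler.
pose dirJ := @DirectedSet J leJ leJ_refl leJ_trans (inhabits (exist _ (0%N, u) (Tu 0%N))) leJ_dir.
exists dirJ, (fun p : dirJ => (sval p).2); split; last first.
  move=> [[n z] /= zT]; exists n.+1 => k /= /subnKC <-; rewrite !subr0.
  set j := (k - n.+1)%N.
  rewrite vlat_ge0_abs ?vlat_meet_ge0 ?vlat_abs_ge0//.
  apply: (@le_trans _ _ (meet u (s n j.+1))); last by apply: zT; exists j.+1.
  rewrite vlat_meetC; apply: vlat_leI2 => //.
  by rewrite /s big_ord_recr /= -[X in X <= _]add0r vlat_lerD2r s0.
split=> //.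
- by move=> p q [].
- by move=> _ [[[n z] /= zT] _ <-]; apply: zT.
(* Solidity of W n will be used on w /\ t, which requires w >= 0. *)
move=> w' [_ w'J]; pose w := join w' 0.
have w0 : 0 <= w := vlat_join_ger _ _.
have wT n : lbound (ubound (T n)) w.
  move=> z zT; rewrite vlat_joinP (zT 0)// andbT.
  by apply: w'J; exists (exist _ (n, z) zT).
suff <- : w = 0 by exact: vlat_join_gel.
apply: WI => n _.
have wsup : supremums (meet w @` T n) w.
  by apply: meet_lower_bound_sup => //; exists u; exact: Tu.
apply: order_closed_directed_sup wsup => //.
- move=> _ [_ [m _ <-] <-]; apply: Wsol (Ws n m).
  rewrite !vlat_ge0_abs ?vlat_meet_ge0//.
  exact: le_trans (vlat_meet_ler _ _) (vlat_meet_ler _ _).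
- by exists (meet w 0), 0.
move=> _ _ [_ [m _ <-] <-] [_ [m' _ <-] <-].
exists (meet w (meet u (s n (maxn m m')))); first by exists (meet u (s n (maxn m m'))) => //; exists (maxn m m').
by split; do 2 apply: vlat_leI2 => //; apply: s_mono; rewrite ?leq_maxl ?leq_maxr.
Qed.

End VectorLatticeTheory.

(** * Increasing sequences of indices *)

Lemma net_tails_increasing_seq (A : directedSet) (P : nat -> set A) :
  (forall n, net_tails A (P n)) ->
  exists alpha : nat -> A,
    (forall m n, (m <= n)%N -> dir_le (alpha m) (alpha n)) /\
    forall n, P n (alpha n).
Proof.
move=> /choice[t tP].
have /choice[d dP] (p : A * A) : exists c, dir_le p.1 c /\ dir_le p.2 c.
  by have [c pc qc] := dir_directed p.1 p.2; exists c.
pose fix alpha n := if n is m.+1 then d (alpha m, t n) else t 0%N.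
exists alpha; split=> [m n /subnKC <-|[|n]].
- elim: (n - m)%N => [|k IHk]; first by rewrite addn0; apply: dir_refl.
  by rewrite addnS; apply: dir_trans IHk _; case: (dP (alpha (m + k)%N, t (m + k).+1)).
- by apply: tP; apply: dir_refl.
by apply: tP; case: (dP (alpha n, t n.+1)).
Qed.

(** * The carrier *)

Section Carrier.
Context {R : realType} {X : topVectorLatticeType R}.
Implicit Types (U V W N C : set X).

Lemma nbhs0_half V : nbhs (0 : X) V ->
  exists2 W, nbhs (0 : X) W & [set x + y | x in W & y in W] `<=` V.
Proof.
move=> V0; have /(_ V) := @add_continuous X (0, 0).
rewrite /= addr0 => /(_ V0)[[P Q] /= [P0 Q0] PQV].
exists (P `&` Q); first exact: filterI.
by move=> _ [x [Px _] [y [_ Qy] <-]]; apply: (PQV (x, y)).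
Qed.

(** Recursive halving inside the given neighbourhoods; the Fatou base makes each
choice solid and order closed. *)
Lemma fatou_normal_seq (U : nat -> set X) : fatou_property X ->
  (forall n, nbhs (0 : X) (U n)) ->
  exists W : nat -> set X, [/\ normal_seq W, forall n, W n `<=` U n &
    forall n, [/\ nbhs (0 : X) (W n), solid (W n) & order_closed (W n)]].
Proof.
move=> [B Bfatou nbhsE] U0.
have /choice[f fP] (p : set X * set X) : exists W,
    nbhs (0 : X) p.1 -> nbhs (0 : X) p.2 ->
    [/\ [set x + y | x in W & y in W] `<=` p.1, W `<=` p.2 &
      [/\ nbhs (0 : X) W, solid W & order_closed W]].
  have [[p1 p2]|np] := pselect (nbhs (0 : X) p.1 /\ nbhs (0 : X) p.2); last first.
    by exists setT => p1 p2; case: np.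
  have [V V0 Vp] := nbhs0_half _ p1.
  have : nbhs (0 : X) (V `&` p.2) by exact: filterI.
  rewrite nbhsE => -[W BW WV]; exists W => _ _; split.
  - move=> _ [x Wx [y Wy <-]]; apply: Vp; exists x; first by case: (WV x Wx).
    by exists y => //; case: (WV y Wy).
  - by move=> x /WV[].
  - have [Wsol Wcl] := Bfatou _ BW; split=> //.
    by exists W.
pose fix W n := if n is m.+1 then f (W m, U n) else f (setT, U 0%N).
have W0 n : nbhs (0 : X) (W n).
  elim: n => [|n IHn] /=.
    by have [] := fP (setT, U 0%N) filterT (U0 _) => _ _ [].
  by have [] := fP (W n, U n.+1) IHn (U0 _) => _ _ [].
exists W; split.
- by move=> n; have [] := fP (W n, U n.+1) (W0 n) (U0 _).
- case=> [|n]; first by have [] := fP (setT, U 0%N) filterT (U0 _).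
  by have [] := fP (W n, U n.+1) (W0 n) (U0 _).
- case=> [|n]; first by have [] := fP (setT, U 0%N) filterT (U0 _).
  by have [] := fP (W n, U n.+1) (W0 n) (U0 _).
Qed.

Lemma carrier_solid : solid (carrier X).
Proof.
move=> x y xy [V [V0 Vn Vy]]; exists V; split=> //.
by have [_ _ _ /(_ x y I xy Vy)] := disjoint_complement_ideal (\bigcap_n V n).
Qed.

Lemma nbhs0_eq0 (x : X) : hausdorff_space X ->
  (forall V, nbhs (0 : X) V -> V x) -> x = 0.
Proof.
move=> Xh xV; apply/esym/Xh => V V' V0 V'x.
by exists x; split; [exact: xV|exact: nbhs_singleton].
Qed.

(** The carrier of a Hausdorff Fatou topology is order dense, in the form that
its disjoint complement is trivial. Each neighbourhood V contains the
intersection N of a normal sequence of solid order closed neighbourhoods;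
N^d is in the carrier, so x is in N^dd = N and thus in V. *)
Lemma disjoint_complement_carrier (x : X) : archimedean_vlat X ->
  hausdorff_space X -> fatou_property X ->
  disjoint_complement (carrier X) x -> x = 0.
Proof.
move=> X_arch Xh Xf xC; apply: nbhs0_eq0 => // V V0.
have [W [Wn WV W0]] := fatou_normal_seq (fun=> V) Xf (fun=> V0).
apply: (WV 0%N); suff /(_ 0%N) : (\bigcap_n W n) x by exact.
apply: disjoint_complementK => //.
- by move=> y z yz Wz n _; have [_ Wsol _] := W0 n; apply: Wsol yz (Wz n _).
- by move=> n _; have [/nbhs_singleton] := W0 n.
- by move=> y z; exact: normal_bigcap_add.
- move=> A y l yW _ yl n _; have [_ _ Wcl] := W0 n.
  by apply: (Wcl A y l) => // a; apply: yW.
move=> y yW; apply: xC; exists W; split=> // n.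
by have [] := W0 n.
Qed.

(** One normal sequence serves countably many carrier elements. Given sequences
G k, the diagonal U n = \bigcap_(k <= n) G k n involves finitely many sets at
each stage, and its intersection is contained in that of every G k. *)
Lemma countable_sub_carrier C : countable C -> C `<=` carrier X ->
  exists U : nat -> set X, [/\ forall n, solid (U n) /\ nbhs (0 : X) (U n),
    normal_seq U & C `<=` disjoint_complement (\bigcap_n U n)].
Proof.
move=> /countable_injP[f f_inj] CX.
have /choice[G GP] (k : nat) : exists V : nat -> set X,
    [/\ forall n, solid (V n) /\ nbhs (0 : X) (V n), normal_seq V &
      forall c, C c -> f c = k -> disjoint_complement (\bigcap_n V n) c].
  have [[c [Cc fc]]|nc] := pselect (exists c, C c /\ f c = k).
    have [V [V0 Vn Vc]] := CX c Cc; exists V; split=> // c' Cc' fc'.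
    by rewrite (f_inj c' c) ?inE// fc fc'.
  exists (fun=> setT); split=> //; first by move=> n; split=> //; exact: filterT.
  by move=> c Cc fc; case: nc; exists c.
pose U n := \bigcap_(k in `I_n.+1) G k n.
exists U; split.
- move=> n; split.
    move=> x y xy Uy k kn; have [/(_ n)[Gsol _] _ _] := GP k.
    exact: Gsol xy (Uy k kn).
  rewrite /U bigcap_mkord; apply: (big_ind (nbhs (0 : X))) => [|V V'|k _].
  - exact: filterT.
  - exact: filterI.
  - by have [/(_ n)[]] := GP k.
- move=> n _ [x Ux [y Uy <-]] k kn; have [_ Gn _] := GP k; apply: Gn.
  have kn1 : `I_n.+2 k by exact: ltnW.
  by exists x; [exact: Ux|exists y => //; exact: Uy].
move=> c Cc y Uy; have [_ Gn /(_ c Cc erefl)] := GP (f c); apply=> n _.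
(* U n controls G k only for n >= k, so the earlier stages need monotonicity. *)
have G0 m z : G (f c) m.+1 z -> G (f c) m z.
  move=> Gz; apply: Gn; exists z => //; exists 0; last by rewrite addr0.
  by have [/(_ m.+1)[_ /nbhs_singleton]] := GP (f c).
suff Gadd m : G (f c) (n + m)%N y -> G (f c) n y.
  by apply: (Gadd (f c)); apply: (Uy (n + f c)%N) => //=; rewrite ltnS leq_addl.
by elim: m => [|m IHm]; rewrite ?addn0// addnS => /G0/IHm.
Qed.

(** The disjoint complement of \bigcap_n U n is a band of the carrier containing
the basis, so it is all of the carrier, and order density applies. *)
Lemma normal_seq_separating : archimedean_vlat X -> hausdorff_space X ->
  fatou_property X -> countable_order_basis (carrier X) ->
  exists U : nat -> set X, [/\ forall n, solid (U n) /\ nbhs (0 : X) (U n),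
    normal_seq U & \bigcap_n U n `<=` [set 0]].
Proof.
move=> X_arch Xh Xf [C [CX Ccount Cband]].
have [U [U0 Un CU]] := countable_sub_carrier C Ccount CX.
exists U; split=> // x Ux; apply: disjoint_complement_carrier => // y.
rewrite -{1}Cband => /(_ (disjoint_complement (\bigcap_n U n))) yU.
rewrite vlat_meetC; apply: yU Ux; split=> //.
by apply: disjoint_complement_band_in; [exact: carrier_solid|exists U].
Qed.

End Carrier.

Theorem theorem6p7 (R : realType) (X : topVectorLatticeType R)
  (X_archimedean : archimedean_vlat X)
  (tau_hausdorff : hausdorff_space X)
  (tau_locally_solid : locally_solid X)
  (tau_fatou : fatou_property X)
  (carrier_basis : countable_order_basis (carrier X))
  (A : directedSet) (x : A -> X) (x_cvg0 : x @ net_tails A --> (0 : X)) :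
  exists alpha : nat -> A,
    (forall m n : nat, (m <= n)%N -> dir_le (alpha m) (alpha n)) /\
    uo_cvg (A := nat_directed) (fun n => x (alpha n)) 0.
Proof.
have [U [U0 _ UI]] :=
  normal_seq_separating X_archimedean tau_hausdorff tau_fatou carrier_basis.
have [W [Wn WU W0]] := fatou_normal_seq U tau_fatou (fun n => (U0 n).2).
have [|alpha [alpha_mono Walpha]] :=
    net_tails_increasing_seq A (fun n => x @^-1` W n).
  by move=> n; apply: x_cvg0; case: (W0 n).
exists alpha; split=> //; apply: (uo_cvg_normal_seq X_archimedean W) => //.
- by move=> n; case: (W0 n).
- by move=> n; case: (W0 n).
- by move=> n; case: (W0 n) => /nbhs_singleton.
- by move=> z Wz; apply: UI => n _; apply: WU; exact: Wz.
Qed.
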